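(* For all integers $s\ge 2$ and $m\ge 0$ with $(s,m)\neq(2,0)$, the graph $K_{1,s}\times P_{2m+2}$ is antimagic.
   Context: $K_{1,s}$ denotes the star with one center and $s$ leaves, and $P_n$ denotes the path on $n$ vertices. For graphs $G$ and $H$, the direct product $G\times H$ has vertex set $V(G)\times V(H)$, with $(x,y)$ adjacent to $(x',y')$ if and only if $xx'\in E(G)$ and $yy'\in E(H)$. A (possibly disconnected) graph $G$ is antimagic if there is a bijection $f:E(G)\to\{1,2,\dots,|E(G)|\}$ such that the vertex sums $\sum_{e\ni v} f(e)$ are pairwise distinct over all vertices $v$ of $G$. *)

(* Defs.v *)
From mathcomp Require Import all_boot.

Set Implicit Arguments.
Unset Strict Implicit.
Unset Printing Implicit Defensive.

Record sgraph := SGraph {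
  svertex :> finType;
  sadj : rel svertex;
  sadj_sym : symmetric sadj;
  sadj_irrefl : irreflexive sadj }.

Definition edges (G : sgraph) : {set {set G}} :=
  [set [set p.1; p.2] | p : G * G & sadj p.1 p.2].

(* The center is [None]; the leaves are [Some i]. *)
Definition star_adj (s : nat) : rel (option 'I_s) :=
  fun x y => isSome x != isSome y.

Lemma star_adj_sym s : symmetric (@star_adj s).
Proof. by move=> x y; rewrite /star_adj eq_sym. Qed.

Lemma star_adj_irrefl s : irreflexive (@star_adj s).
Proof. by move=> x; rewrite /star_adj eqxx. Qed.

Definition star (s : nat) : sgraph :=
  SGraph (@star_adj_sym s) (@star_adj_irrefl s).

Definition path_adj (n : nat) : rel 'I_n :=
  fun i j => (i.+1 == j :> nat) || (j.+1 == i :> nat).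

Lemma path_adj_sym n : symmetric (@path_adj n).
Proof. by move=> i j; rewrite /path_adj orbC. Qed.

Lemma path_adj_irrefl n : irreflexive (@path_adj n).
Proof. by move=> i; rewrite /path_adj orbb gtn_eqF. Qed.

Definition path_graph (n : nat) : sgraph :=
  SGraph (@path_adj_sym n) (@path_adj_irrefl n).

Section DirectProduct.
Variables G H : sgraph.

Definition dprod_adj : rel (G * H) :=
  fun u v => sadj u.1 v.1 && sadj u.2 v.2.

Lemma dprod_adj_sym : symmetric dprod_adj.
Proof.
by move=> u v; rewrite /dprod_adj sadj_sym [sadj u.2 _]sadj_sym.
Qed.

Lemma dprod_adj_irrefl : irreflexive dprod_adj.
Proof. by move=> u; rewrite /dprod_adj sadj_irrefl. Qed.

Definition direct_product : sgraph := SGraph dprod_adj_sym dprod_adj_irrefl.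
End DirectProduct.

Definition vertex_sum (G : sgraph) (f : {set G} -> nat) (v : G) : nat :=
  \sum_(e in edges G | v \in e) f e.

(* Only the values of [f] on [edges G] matter; the first two conditions say
   that [f] restricts to a bijection from [edges G] onto {1, ..., #|edges G|}. *)
Definition antimagic (G : sgraph) : Prop :=
  exists f : {set G} -> nat,
    [/\ {in edges G &, injective f},
        forall k : nat, (1 <= k <= #|edges G|) <->
                        (exists2 e, e \in edges G & f e = k)
      & injective (vertex_sum f)].

(* Main.v *)
Require Import Defs.
From mathcomp Require Import all_boot.
From mathcomp Require Import zify.

(** The graph consists of two isomorphic copies of [P_(2m+2)] in which every
    second vertex, starting at one end, is replaced by [s] "leaves". In each
    copy count the distance [u] from the end carrying the pendant leaves, so that
    leaves sit at even [u] and centers at odd [u]. The [2s] pendant edges get the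
    labels [1..2s]; every other leaf has degree 2 and gets two consecutive labels
    [2q+1, 2q+2], so that its sum is 3 mod 4. Which of the two labels goes to
    which side alternates with the distance, and the [2s] strands are dealt
    alternately to the two copies; the center sums then avoid the leaf sums,
    either modulo 4 or by size. *)

(** * Antimagic labelings through an index type *)

(** Surjectivity need not be asked of [g]: an injection between finite sets of equal size is
    onto. *)
Lemma antimagic_param (G : sgraph) (E : finType) (phi : E -> {set G})
    (g : E -> nat) :
    injective phi -> (forall e, (e \in edges G) = (e \in codom phi)) ->
    injective g -> (forall x, 1 <= g x <= #|E|) ->
    injective (fun v => \sum_(x | v \in phi x) g x) ->
  antimagic G.
Proof.
move=> phi_inj edgesE g_inj g_bound sum_inj.
have edgesI : edges G = phi @: E.
  by apply/setP=> e; rewrite edgesE; apply/codomP/imsetP => -[x]; exists x.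
have cardE : #|edges G| = #|E| by rewrite edgesI card_imset.
pose f e := if [pick x | phi x == e] is Some x then g x else 0.
have fphi x : f (phi x) = g x.
  rewrite /f; case: pickP => [y /eqP/phi_inj->//|/(_ x)].
  by rewrite eqxx.
exists f; split.
- move=> d e; rewrite !edgesE => /codomP[x ->] /codomP[y ->].
  by rewrite !fphi => /g_inj->.
- move=> k; rewrite cardE; split; last first.
    by case=> e; rewrite edgesE => /codomP[x ->] <-; rewrite fphi.
  move=> k_bound.
  (* Labels start at 1 and ordinals at 0, hence the shift. *)
  have bound x : (g x).-1 < #|E| by move: (g_bound x); lia.
  pose h x := Ordinal (bound x).
  have h_inj : injective h.
    move=> x y [] eqg; apply: g_inj.
    by move: (g_bound x) (g_bound y) eqg; lia.
  have k_lt : k.-1 < #|E| by lia.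
  have := inj_card_onto h_inj; rewrite card_ord => /(_ (leqnn _)).
  move=> /(_ (Ordinal k_lt))/codomP[x [eqk]].
  exists (phi x); first by rewrite edgesE codom_f.
  by rewrite fphi; move: (g_bound x) eqk k_bound; lia.
- have vsE v : vertex_sum f v = \sum_(x | v \in phi x) g x.
    rewrite /vertex_sum edgesI big_imset_cond /=; last by move=> x y _ _ /phi_inj.
    by apply: eq_bigr => x _; rewrite fphi.
  by move=> v w; rewrite !vsE => /sum_inj.
Qed.

(** * The labels *)

(** The term [b * s] stands on the left to avoid truncated subtraction. *)
Lemma sum_arith s a b :
  \sum_(i < s) (a + b * (2 * i)) + b * s = s * a + b * s * s.
Proof.
elim: s => [|s IHs]; first by rewrite big_ord0 !muln0.
rewrite big_ord_recr /=.
by move: IHs; set S := \sum_(i < s) _; nia.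
Qed.

(* Label of the edge joining distances [t] and [t.+1] in strand [i] of copy [c];
   [k] numbers the [2s] strands of both copies together. *)
Definition label (s : nat) (c : bool) (i t : nat) : nat :=
  let k := 2 * i + c in
  if t is t'.+1 then
    (2 * t'./2 + 1) * (2 * s) + 2 * k + 1 + (odd t' == odd t'./2)
  else k + 1.

Lemma label0 s c i : label s c i 0 = 2 * i + c + 1.
Proof. by []. Qed.

Lemma label_odd s c i r :
  label s c i r.*2.+1 = (2 * r + 1) * (2 * s) + 2 * (2 * i + c) + 1 + ~~ odd r.
Proof. by rewrite /label doubleK odd_double; case: (odd r). Qed.

Lemma label_even s c i r :
  label s c i r.+1.*2 = (2 * r + 1) * (2 * s) + 2 * (2 * i + c) + 1 + odd r.
Proof.
by rewrite doubleS /label -uphalfE uphalf_double /= odd_double; case: (odd r).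
Qed.

Lemma label_bound s m c i t : i < s -> t <= m.*2 ->
  1 <= label s c i t <= 2 * s * m.*2.+1.
Proof.
move=> lis; have lc : c <= 1 by case: c.
case: t => [|t] ltm; rewrite /label; first by nia.
have : t./2 < m by lia.
have : (odd t == odd t./2) <= 1 by case: eqP.
by move: (t./2) (nat_of_bool (_ == _)) => r w; nia.
Qed.

(** Labels above [2 * s] form blocks of length [4 * s], one for each half of [t']. Size fixes the
    block, parity the last bit, and what remains is the strand number, whose parity is the copy. *)
Lemma label_inj s c i t c' i' t' : i < s -> i' < s ->
  label s c i t = label s c' i' t' -> [/\ c = c', i = i' & t = t'].
Proof.
move=> lis lis'.
have lc : c <= 1 by case: c.
have lc' : c' <= 1 by case: c'.
have ci_inj : 2 * i + c = 2 * i' + c' -> c = c' /\ i = i'.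
  by case: c c' {lc lc'} => -[] /=; lia.
case: t t' => [|t] [|t']; rewrite /label.
- by move=> /addIn/ci_inj[-> ->].
- by nia.
- by nia.
set w := odd t == _; set w' := odd t' == _ => eql.
have lw : w <= 1 by case: (w).
have lw' : w' <= 1 by case: (w').
have eqr : t./2 = t'./2.
  by move: (t./2) (t'./2) eql => r r' eql; case: (ltngtP r r') => // ltr; nia.
have eqw : w = w'.
  move: eql; rewrite eqr; move: (_ * (2 * s)) => A.
  by case: (w) (w') => -[] /=; lia.
have [|-> ->] := ci_inj; first by move: eql; rewrite eqr eqw; lia.
split=> //; congr _.+1.
rewrite -(odd_double_half t) -(odd_double_half t') eqr; congr (nat_of_bool _ + _).
by move: eqw; rewrite /w /w' eqr; do 3!case: (odd _).
Qed.

(** * Coordinates on the two copies and their edges *)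

Section Coordinates.
Variables s m : nat.
Local Notation G := (direct_product (star s) (path_graph m.*2.+2)).
Local Notation E := (bool * 'I_s * 'I_m.*2.+1)%type.

(* The vertex at distance [u] from the pendant end of copy [c]; [i] only matters
   for the leaves, i.e. for even [u]. *)
Definition node (c : bool) (i : 'I_s) (u : nat) : G :=
  (if odd u then None else Some i,
   if c then inord u else rev_ord (inord u)).

(** Every edge swaps center and leaf and flips the parity of the path coordinate, so this bit is
    constant along edges. *)
Definition node_copy (v : G) : bool := odd v.2 == (v.1 == None).

Definition node_dist (v : G) : nat :=
  if node_copy v then v.2 : nat else m.*2.+1 - v.2.

Lemma node_dist_bound v : node_dist v <= m.*2.+1.
Proof. by rewrite /node_dist; case: ifP; case: v => x [y] /=; lia. Qed.

Lemma odd_node_dist v : odd (node_dist v) = (v.1 == None).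
Proof.
rewrite /node_dist /node_copy; case: v => x [y lty] /=.
by case: (x == None); case: eqP; lia.
Qed.

Lemma node_eq v c i u : u <= m.*2.+1 ->
  (v == node c i u) =
  [&& node_copy v == c, node_dist v == u & (v.1 == None) || (v.1 == Some i)].
Proof.
move=> leu; rewrite -pair_eqE /= -val_eqE /=.
have -> : val (if c then inord u : 'I_m.*2.+2 else rev_ord (inord u)) =
          (if c then u else m.*2.+1 - u).
  by case: c => /=; rewrite inordK //; lia.
rewrite /node_dist /node_copy; case: v => x [y lty] /=.
case: x => [j|] /=.
  have -> : (Some j == (if odd u then None else Some i)) = ~~ odd u && (j == i).
    by case: (odd u).
  have -> : (Some j == Some i :> option 'I_s) = (j == i) by [].
  case: (j == i); rewrite ?andbF //= ?andbT.
  by case: c; case: (boolP (odd y)) => /=; lia.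
have -> : (None == (if odd u then None else Some i)) = odd u.
  by case: (odd u).
by rewrite andbT; case: c; case: (boolP (odd y)) => /=; lia.
Qed.

Lemma node_coord_inj v w : v.1 = w.1 -> node_copy v = node_copy w ->
  node_dist v = node_dist w -> v = w.
Proof.
case: v w => [x [y lty]] [x' [y' lty']] /= <- eqc eqd; congr pair; apply: val_inj.
by move: eqd; rewrite /node_dist -eqc /=; case: ifP => _ /=; lia.
Qed.

Definition edge (x : E) : {set G} :=
  [set node x.1.1 x.1.2 x.2; node x.1.1 x.1.2 x.2.+1].

Lemma in_edge v x :
  (v \in edge x) =
  [&& node_copy v == x.1.1,
      (x.2 == node_dist v :> nat) || (x.2.+1 == node_dist v)
    & (v.1 == None) || (v.1 == Some x.1.2)].
Proof.
case: x => -[c i] [t ltt] /=.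
rewrite !inE /= !node_eq; try lia.
by rewrite [t == _]eq_sym [_.+1 == _]eq_sym; do !case: (_ == _) => //=.
Qed.

Lemma node_coords c i u : u <= m.*2.+1 ->
  node_copy (node c i u) = c /\ node_dist (node c i u) = u.
Proof.
move=> leu; have := node_eq (node c i u) c i u leu.
by rewrite eqxx => /esym/and3P[/eqP-> /eqP->].
Qed.

(** Both ends of one edge lie in the other, so the distances agree; the end at even distance is a
    leaf and fixes the strand. *)
Lemma edge_inj : injective edge.
Proof.
move=> x x' eqE.
have at_x u : (u == x.2 :> nat) || (u == x.2.+1) ->
    node x.1.1 x.1.2 u \in edge x'.
  by rewrite -eqE !inE => /orP[] /eqP->; rewrite eqxx ?orbT.
have := at_x x.2; have := at_x x.2.+1; rewrite !eqxx orbT => /(_ isT) + /(_ isT).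
case: x x' {at_x eqE} => -[c i] [t ltt] [[c' i'] [t' ltt']] /=.
rewrite !in_edge /=.
have [-> ->] := node_coords c i t ltac:(lia).
have [-> ->] := node_coords c i t.+1 ltac:(lia).
move=> /and3P[/eqP<- /orP h1 ai1] /and3P[_ /orP h0 ai0].
have eqt : t = t' by case: h1 h0 => /eqP h1 [] /eqP h0; lia.
suff -> : i = i' by congr (_, _, _); apply: val_inj.
by move: ai0 ai1 => /=; case: (odd t) => /=; [move=> _|move=> + _] => /eqP[].
Qed.

Lemma node_adj c i t : t < m.*2.+1 ->
  @sadj G (node c i t) (node c i t.+1).
Proof.
move=> ltt; rewrite /= /dprod_adj /= /star_adj /path_adj.
by case: c => /=; rewrite ?inordK; case: (odd t) => //=; lia.
Qed.

(** With the center put first, the other end is a leaf, whose index names the strand. *)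
Lemma adj_edge v w : @sadj G v w -> v.1 == None ->
  [set v; w] \in codom edge.
Proof.
case: v w => [x y] [[i|] z]; rewrite /= /dprod_adj /= /star_adj /path_adj;
  case: x => //= adj _.
pose v : G := (None, y); pose w : G := (Some i, z).
have eqc : node_copy v = node_copy w.
  have -> : node_copy v = odd y by rewrite /node_copy eqb_id.
  have -> : node_copy w = ~~ odd z by rewrite /node_copy eqbF_neg.
  by case: y z adj {v w} => [y ?] [z ?] /=; lia.
have dv := node_dist_bound v; have dw := node_dist_bound w.
have vE : v = node (node_copy v) i (node_dist v).
  by apply/eqP; rewrite node_eq ?eqxx.
have wE : w = node (node_copy v) i (node_dist w).
  by apply/eqP; rewrite node_eq ?eqxx ?eqc //= eqxx.
have : (node_dist v).+1 = node_dist w \/ (node_dist w).+1 = node_dist v.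
  rewrite /node_dist -eqc /=; move: (node_copy v) => b.
  by case: y z adj {v w eqc dv dw vE wE} => [y ?] [z ?] /=; case: b; lia.
rewrite -/v -/w => -[] eqd.
  have ltd : node_dist v < m.*2.+1 by lia.
  apply/codomP; exists (node_copy v, i, Ordinal ltd).
  by rewrite /edge /= eqd -wE -vE.
have ltd : node_dist w < m.*2.+1 by lia.
apply/codomP; exists (node_copy v, i, Ordinal ltd).
by rewrite /edge /= eqd -wE -vE setUC.
Qed.

Lemma edges_codom e : (e \in edges G) = (e \in codom edge).
Proof.
apply/imsetP/codomP => [[[v w]]|[[[c i] [t ltt]] ->]]; last first.
  by exists (node c i t, node c i t.+1); rewrite // inE node_adj.
rewrite inE /= => adj ->; apply/codomP.
have [v0|v0] := boolP (v.1 == None); first by rewrite adj_edge.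
rewrite setUC adj_edge //; first by rewrite sadj_sym.
by move: adj v0 => /= /andP[+ _]; case: v.1 w.1 => [?|] [?|].
Qed.

(** * Vertex sums, strand by strand *)

(** The share of one strand in a vertex sum; an edge that would lie beyond an end counts 0. *)
Definition strand_sum (c : bool) (i u : nat) : nat :=
  (if u <= m.*2 then label s c i u else 0) +
  (if u is t.+1 then label s c i t else 0).

Lemma sum_strand c i u : u <= m.*2.+1 ->
  \sum_(t < m.*2.+1 | (t == u :> nat) || (t.+1 == u)) label s c i t =
  strand_sum c i u.
Proof.
move=> leu; rewrite (bigID (fun t : 'I_m.*2.+1 => t == u :> nat)) /=.
rewrite /strand_sum; congr (_ + _).
  rewrite (eq_bigl (fun t : 'I__ => t == u :> nat)) => [|t]; last by lia.
  case: leqP => [leu'|ltu].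
    by rewrite (big_pred1 (Ordinal (leu' : u < m.*2.+1))).
  by rewrite big_pred0 // => -[t ltt] /=; lia.
case: u leu => [|u] leu.
  by rewrite big_pred0 // => -[t ltt] /=; lia.
rewrite (big_pred1 (Ordinal (leu : u < m.*2.+1))) // => t /=.
by rewrite -val_eqE /=; lia.
Qed.

Lemma sum_in_edge v :
  \sum_(x | v \in edge x) label s x.1.1 x.1.2 x.2 =
  if v.1 is Some i then strand_sum (node_copy v) i (node_dist v)
  else \sum_(i < s) strand_sum (node_copy v) i (node_dist v).
Proof.
under eq_bigl do rewrite in_edge.
(* The filter keeps all strands at a center and one at a leaf, so both cases are treated at once. *)
transitivity (\sum_(i < s | (v.1 == None) || (v.1 == Some i))
                strand_sum (node_copy v) i (node_dist v)); last first.
  case: v.1 => [i|] //.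
  by rewrite (big_pred1 i) => [//|j]; rewrite /= eq_sym.
under [RHS]eq_bigr do rewrite -sum_strand ?node_dist_bound //.
rewrite (pair_big_dep _ _) /=.
rewrite (reindex_onto (fun p : 'I_s * 'I_m.*2.+1 => (node_copy v, p.1, p.2))
                     (fun x => (x.1.2, x.2))) /=.
  by apply: eq_bigl => -[i t] /=; rewrite !eqxx /= andbT [LHS]andbC.
by case=> -[c i] t /= /and3P[/eqP<-].
Qed.

End Coordinates.

(** * Values of the leaf and center sums *)

Lemma leaf_sum0 s m c i : strand_sum s m c i 0 = 2 * i + c + 1.
Proof. by rewrite /strand_sum /= addn0. Qed.

(** The two labels are [2 * q + 1] and [2 * q + 2], in either order, with
    [q = s * (2 * r + 1) + 2 * i + c]. *)
Lemma leaf_sumS s m c i r : r < m ->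
  strand_sum s m c i r.+1.*2 = 4 * s * (2 * r + 1) + 4 * (2 * i + c) + 3.
Proof.
move=> ltr; rewrite /strand_sum ifT; last by lia.
rewrite label_even doubleS label_odd.
by case: (odd r) => /=; nia.
Qed.

(* The four cases: pendant stars when [m = 0], the center next to the pendant
   leaves, the interior centers, and the center at the far end. *)
Definition center_mean (s m : nat) (c : bool) (r : nat) : nat :=
  if m == 0 then s + c
  else if r == 0 then 5 * s + 3 * c
  else if r < m then (8 * r + 4) * s + 4 * c - 2 * odd r
  else 4 * m * s + 2 * c - odd m.

(** The strand shares form an arithmetic progression in [i], of step 6, 2, 8 or 4 in the four cases
    of the proof. *)
Lemma center_sum s m c r : 0 < s -> r <= m ->
  \sum_(i < s) strand_sum s m c i r.*2.+1 = s * center_mean s m c r.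
Proof.
move=> s0 ler; rewrite /center_mean.
have arith F a b : (forall i, F i = a + b * (2 * i)) ->
    \sum_(i < s) F i + b * s = s * a + b * s * s.
  by move=> FE; rewrite -sum_arith; congr (_ + _); apply: eq_bigr => i _.
have c1 : c <= 1 by case: c.
have sumE i : strand_sum s m c i r.*2.+1 =
    (if r < m then label s c i r.*2.+1 else 0) + label s c i r.*2.
  by rewrite /strand_sum ltn_double.
under eq_bigr do rewrite sumE.
case: r ler {sumE} => [|r] ler; case: ltnP => ltm /=.
- rewrite ifF; last by lia.
  have := arith (fun i => label s c i 1 + label s c i 0)
    (2 * s + 3 * c + 3) 3
    (fun i => ltac:(cbv beta; rewrite label0 (label_odd s c i 0) /=; lia)).
  by move: (\sum_(i < s) _) => S; nia.
- rewrite ifT; last by lia.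
  have := arith (fun i => 0 + label s c i 0) (c + 1) 1
    (fun i => ltac:(cbv beta; rewrite label0; lia)).
  by move: (\sum_(i < s) _) => S; nia.
- rewrite ifF; last by lia.
  (* By the alternation, both labels of a strand at this center carry the same last bit, hence
     [2 * odd r]. *)
  have := arith (fun i => label s c i r.+1.*2.+1 + label s c i r.+1.*2)
    (8 * r.+1 * s + 4 * c + 2 + 2 * odd r) 4
    (fun i => ltac:(cbv beta; rewrite label_odd label_even /=; case: (odd r) => /=; lia)).
  by move: (\sum_(i < s) _) => S; case: (odd r) => /=; nia.
have -> : m = r.+1 by lia.
have := arith (fun i => 0 + label s c i r.+1.*2)
  ((2 * r + 1) * (2 * s) + 2 * c + 1 + odd r) 2
  (fun i => ltac:(cbv beta; rewrite label_even; lia)).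
by move: (\sum_(i < s) _) => S /=; case: (odd r) => /=; nia.
Qed.

(** * Distinctness of the sums *)

(** Pendant sums are at most [2 * s], the others exceed [4 * s]. Among the latter, raising [r] by
    one adds [8 * s], more than the strands can vary. *)
Lemma leaf_sum_inj s m c i r c' i' r' : i < s -> i' < s -> r <= m -> r' <= m ->
  strand_sum s m c i r.*2 = strand_sum s m c' i' r'.*2 ->
  [/\ c = c', i = i' & r = r'].
Proof.
move=> lis lis'.
have c1 : c <= 1 by case: c.
have c1' : c' <= 1 by case: c'.
have ci_inj : 2 * i + c = 2 * i' + c' -> c = c' /\ i = i'.
  by case: c c' {c1 c1'} => -[] /=; lia.
case: r r' => [|r] [|r'] ler ler'; rewrite ?leaf_sum0 ?leaf_sumS //.
- by move=> /addIn/ci_inj[-> ->].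
- by nia.
- by nia.
move=> eqS; have eqr : r = r' by case: (ltngtP r r') => // ltr; nia.
rewrite eqr; move: eqS; rewrite eqr => eqS.
by have [|-> ->] := ci_inj; first by lia.
Qed.

(** Before the far end the means grow with [r] faster than the corrections can undo. The far mean
    may fall among interior ones: the leading terms are [4 * s] times [m] and [4 * s] times an odd
    number, so they coincide only for odd [m], where [odd m] makes the far mean odd and the interior
    ones are even. *)
Lemma center_mean_inj s m c r c' r' : 2 <= s -> r <= m -> r' <= m ->
  center_mean s m c r = center_mean s m c' r' -> c = c' /\ r = r'.
Proof.
move=> s2.
wlog lerr' : c c' r r' / r <= r'.
  move=> IH ler ler' eqm; case: (leqP r r') => [le|/ltnW le]; first exact: IH.
  by have [] := IH c' c r' r le ler' ler (esym eqm).
move=> ler ler'; move: lerr'; rewrite leq_eqVlt => /orP[/eqP<-|ltr].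
  move=> eqm; split=> //; move: eqm; rewrite /center_mean; do 3?[case: ifP => _].
  - by case: c c' => -[] /=; lia.
  - by case: c c' => -[] /=; lia.
  - have : (8 * r + 4) * s >= 8 by nia.
    by move: (_ * s) => A; case: c c' (odd r) => -[] [] /=; lia.
  case: m ler ler' => [|m] _ _; first by case: c c' => -[] //=; lia.
  have : 4 * m.+1 * s >= 8 by nia.
  by move: (_ * s) => A; case: c c' (odd _) => -[] [] /=; lia.
have c1 : c <= 1 by case: c.
have c1' : c' <= 1 by case: c'.
have o1 (n : nat) : odd n <= 1 by case: (odd n).
rewrite /center_mean (_ : (m == 0) = false); last by lia.
rewrite (_ : (r' == 0) = false); last by lia.
rewrite (_ : r < m = true); last by lia.
have [r0|r0] := eqVneq r 0.
  case: ltnP => ltm.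
    have : (8 * r' + 4) * s >= 12 * s by nia.
    by move: ((8 * r' + 4) * s) (o1 r') => A; lia.
  have [->|m1] := eqVneq m 1; first by rewrite /=; lia.
  have : 4 * m * s >= 8 * s by nia.
  by move: (4 * m * s) (o1 m) => A; lia.
case: ltnP => ltm.
  have : (8 * r' + 4) * s >= (8 * r + 4) * s + 8 * s by nia.
  by move: (o1 r') (o1 r); move: ((8 * r' + 4) * s) ((8 * r + 4) * s) => A B; lia.
have [mo|me] := boolP (odd m).
  have -> : (8 * r + 4) * s = 2 * ((4 * r + 2) * s) by nia.
  have -> : 4 * m * s = 2 * (2 * m * s) by nia.
  have : (4 * r + 2) * s >= 2 by nia.
  have : 2 * m * s >= 2 by nia.
  by move: ((4 * r + 2) * s) (2 * m * s) (o1 r) => A B; lia.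
have [p mE] : exists p, m = 2 * p by exists m./2; lia.
rewrite mE; case: (ltnP r p) => ltp.
  have : 4 * (2 * p) * s >= (8 * r + 4) * s + 4 * s by nia.
  by move: ((8 * r + 4) * s) (4 * (2 * p) * s) (o1 r) => A B /=; lia.
have : (8 * r + 4) * s >= 4 * (2 * p) * s + 4 * s by nia.
by move: ((8 * r + 4) * s) (4 * (2 * p) * s) (o1 r) => A B /=; lia.
Qed.

(* Leaf sums are at most 2s or congruent to 3 mod 4; the center sums exceed 2s,
   and those congruent to 3 mod 4 exceed every leaf sum. *)
Lemma leaf_sum_neq_center s m c i r c' r' : 2 <= s -> (s, m) <> (2, 0) ->
    i < s -> r <= m -> r' <= m ->
  strand_sum s m c i r.*2 <> s * center_mean s m c' r'.
Proof.
move=> s2 sm lis ler ler'.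
have c1 : c <= 1 by case: c.
have c1' : c' <= 1 by case: c'.
have o1 (n : nat) : odd n <= 1 by case: (odd n).
(* This handles the pendant leaves. For [m = 0] the mean is [s + c'], which is 2 exactly in the
   excluded case with [c' = 0]. *)
have big_mean : 2 < center_mean s m c' r'.
  rewrite /center_mean; case: eqP => [m0|m0].
    have : s <> 2 by move=> s2'; apply: sm; rewrite s2' m0.
    by lia.
  case: eqP => r0; first by lia.
  case: (ltnP r' m) => ltm; first by move: (o1 r'); nia.
  have : 4 * m * s >= 8 by nia.
  by move: (4 * m * s) (o1 m); lia.
case: r ler => [|r] ler; first by rewrite leaf_sum0; nia.
rewrite leaf_sumS //.
have -> : 4 * s * (2 * r + 1) + 4 * (2 * i + c) + 3 =
          4 * (s * (2 * r + 1) + (2 * i + c)) + 3 by nia.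
have : s * (2 * r + 1) + (2 * i + c) < s * (2 * m + 1) by nia.
move: (s * _ + _) => L ltL.
rewrite /center_mean ifF; last by lia.
case: eqP => r0.
  (* The sum [s * (5 * s + 3 * c')] is even unless [s] is odd and [c' = 0]; then it is 1 mod 4. *)
  have [[a sE]|[a sE]] : (exists a, s = 2 * a) \/ (exists a, s = 2 * a + 1).
  - by case: (boolP (odd s)) => so; [right|left]; exists s./2; lia.
  - by rewrite {1}sE -mulnA; move: (a * _) => A; lia.
  rewrite sE; case: c' {c1' big_mean} => /=; rewrite ?muln1 ?muln0.
    have -> : (2 * a + 1) * (5 * (2 * a + 1) + 3) =
              2 * ((2 * a + 1) * (5 * a + 4)) by nia.
    by move: (_ * (_ + 4)) => A; lia.
  have -> : (2 * a + 1) * (5 * (2 * a + 1) + 0) =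
            4 * (5 * a * a + 5 * a + 1) + 1 by nia.
  by move: (_ + _ + 1) => A; lia.
case: ltnP => ltm.
  have -> : (8 * r' + 4) * s + 4 * c' - 2 * odd r' =
    2 * ((4 * r' + 2) * s + 2 * c' - odd r') by lia.
  by rewrite mulnCA; lia.
have [mo|me] := boolP (odd m); last first.
  have -> : 4 * m * s + 2 * c' - false = 2 * (2 * m * s + c') by lia.
  by rewrite mulnCA; lia.
(* The far center with [m] odd: [s = 2] gives an even sum, and larger [s] is settled by size, except
   [s = 3], [c' = 0]. There [m = 1] gives 33 against leaf sums up to 35, but [36 * m - 3] is 1 mod
   4. *)
case: c' {c1' big_mean} => /=.
  have [->|s3] := eqVneq s 2; first by lia.
  by nia.
have [s4|s4] := leqP 4 s; first by nia.
have [->|s3] := eqVneq s 2; first by lia.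
have -> : s = 3 by lia.
by lia.
Qed.

Lemma antimagic_star_path s m : 2 <= s -> (s, m) <> (2, 0) ->
  antimagic (direct_product (star s) (path_graph m.*2.+2)).
Proof.
move=> s2 sm.
apply: (antimagic_param _ _ (edge s m) (fun x => label s x.1.1 x.1.2 x.2)).
- exact: edge_inj.
- exact: edges_codom.
- move=> [[c i] t] [[c' i'] t'] /= /label_inj[] // -> /val_inj-> /val_inj->.
  by [].
- move=> [[c i] t] /=; rewrite !card_prod card_bool !card_ord.
  by apply: label_bound => //; rewrite -ltnS.
move=> v w; rewrite !sum_in_edge.
(* The parity of the distance separates leaves from centers, so its half serves as the index [r] for
   both. *)
have dist_half u : node_dist s m u =
    if u.1 == None then (node_dist s m u)./2.*2.+1 else (node_dist s m u)./2.*2.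
  by rewrite -odd_node_dist; case: ifP; lia.
have half_bound u : (node_dist s m u)./2 <= m.
  by have := node_dist_bound s m u; lia.
move: (dist_half v) (dist_half w) (half_bound v) (half_bound w).
move: (node_dist s m v)./2 (node_dist s m w)./2 => r r' + + ler ler'.
case v1: v.1 => [i|]; case w1: w.1 => [j|] /= dv dw; rewrite dv dw.
- move=> /leaf_sum_inj[] // eqc /val_inj eqi eqr.
  by apply: node_coord_inj; rewrite ?v1 ?w1 ?eqi ?dv ?dw ?eqr.
- by rewrite center_sum ?(ltnW s2) // => /leaf_sum_neq_center[].
- by rewrite center_sum ?(ltnW s2) // => /esym/leaf_sum_neq_center[].
rewrite !center_sum ?(ltnW s2) // => /eqP; rewrite eqn_pmul2l ?(ltnW s2) //.
move=> /eqP/center_mean_inj[] // eqc eqr.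
by apply: node_coord_inj; rewrite ?v1 ?w1 ?dv ?dw ?eqr.
Qed.

Theorem theorem2p4 (s m : nat) (hs : 2 <= s) (hsm : (s, m) <> (2, 0)) :
  antimagic (direct_product (star s) (path_graph (2 * m + 2))).
Proof.
have -> : 2 * m + 2 = m.*2.+2 by lia.
exact: antimagic_star_path.
Qed.
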